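(* Let $\mathcal T = (I, \mathbf P, \{T_i\}_{i \in I}, \mu, \{ \alpha_i\}_{i \in I})$ be a random number system satisfying the CLT-property with constant $\sigma>0$ and let $(S, \tilde \mu, \mathcal E)$ be a number theoretic fibered map (NTFM) that satisfies the zero-property. Assume that $h^{\mathrm{fib}}(\mathcal T), h_{\tilde \mu}(S) \in (0, \infty)$. For $n\in\mathbb N$, $\omega\in I^{\mathbb N}$ and $x\in[0,1)$ let $$m_{\mathcal T,S}(n,\omega,x) = \sup\{m \in \mathbb{N}: \alpha_{\omega,n}(x) \subseteq \mathcal E_m(x)\}.$$ Then for all $u \in \mathbb{R}$, $$\lim_{n \rightarrow \infty} \mu\Big(\Big\{(\omega,x) \in I^\mathbb N \times [0,1)\, :\, \frac{m_{\mathcal T,S}(n,\omega,x) - n\frac{h^{\mathrm{fib}}(\mathcal T)}{h_{\tilde \mu}(S)}}{\kappa \sqrt n} \leq u\Big\}\Big) = \frac1{\sqrt{2 \pi}} \int_{-\infty}^u e^{-t^2/2} \, dt,$$ where $\kappa = \frac{\sigma}{h_{\tilde \mu}(S)}$.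
   Context: Conventions. $\mathbb N=\{1,2,\ldots\}$; $\lambda$ is Lebesgue measure on $[0,1)$ and $\mathcal B$ its Borel $\sigma$-algebra. A partition of a measure space $(X,\mathcal F,m)$ is an at most countable collection of measurable sets that are pairwise disjoint and cover $X$, both modulo $m$-null sets; $\mathcal P(x)$ is the element of $\mathcal P$ containing $x$; $\vee$ denotes common refinement; $H_m(\mathcal P)=-\sum_{P\in\mathcal P}m(P)\log m(P)$. $h_m(T)$ denotes the measure theoretic (Kolmogorov–Sinai) entropy of an $m$-preserving map $T$. The convention $\sup\emptyset=0$ is used. Random number systems. Let $I$ be a Polish space with Borel $\sigma$-algebra $\mathcal B_I$, $\tau$ the left shift on $I^{\mathbb N}$, and $\mathbf P$ a Borel probability measure on $(I^{\mathbb N},\mathcal B_I^{\mathbb N})$ such that $\mathbf P(\tau^{-1}A)=0$ whenever $\mathbf P(A)=0$. For each $i\in I$ let $T_i:[0,1)\to[0,1)$ be Borel measurable and let $\alpha_i=\{A_{i,0},A_{i,1},\ldots\}$ be a partition of $[0,1)$ by countably many subintervals (possibly including empty sets). Let $F(\omega,x)=(\tau\omega,T_{\omega_1}(x))$ on $I^{\mathbb N}\times[0,1)$ and let $\mu$ be an $F$-invariant probability measure. Put $T_\omega^0=\mathrm{id}$, $T_\omega^n=T_{\omega_n}\circ\cdots\circ T_{\omega_1}$. The random level $n$ cylinders along $\omega$ are the elements of $\alpha_{\omega,n}=\bigvee_{k=0}^{n-1}(T_\omega^k)^{-1}\alpha_{\omega_{k+1}}$. The tuple $\mathcal T=(I,\mathbf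 P,\{T_i\}_{i\in I},\mu,\{\alpha_i\}_{i\in I})$ is a random number system if: (r1) $(i,x)\mapsto T_i(x)$ is measurable on $I\times[0,1)$; (r2) for each $i\in I$, $A\in\alpha_i$, $T_i|_A$ is strictly monotone and continuous; (r3) the sets $\Delta(j)=\{(\omega,x):x\in A_{\omega_1,j}\}$, $j\ge0$, belong to $\mathcal B_I^{\mathbb N}\times\mathcal B$; put $\Delta=\{\Delta(j):j\ge0\}$; (r4) for $\mathbf P$-a.a. $\omega$: for all $B\in\mathcal B$, $\lambda(B)=0$ implies $\lambda(T_{\omega_1}^{-1}B)=0$; (r5) for $\mathbf P$-a.a. $\omega$, the $\sigma$-algebra generated by $\bigcup_n\alpha_{\omega,n}$ equals $\mathcal B$ up to $\lambda$-null sets; (r6) $\mu$ is ergodic for $F$ and equivalent to $\mathbf P\times\lambda$; (r7) $H_\mu(\Delta)<\infty$, or, more generally, $\int_{I^{\mathbb Z}}H_{\hat\mu_{\hat\omega}}(\alpha_{\hat\omega_1})\,d\hat\nu(\hat\omega)<\infty$, with $\hat\mu_{\hat\omega},\hat\nu$ as follows. Two-sided extension. Let $\hat\tau$ be the left shift on $I^{\mathbb Z}$, $\hat F(\hat\omega,x)=(\hat\tau\hat\omega,T_{\hat\omega_1}(x))$ on $I^{\mathbb Z}\times[0,1)$, and $\Pi:I^{\mathbb Z}\times[0,1)\to I^{\mathbb N}\times[0,1)$ the canonical projection (keeping the coordinates $\hat\omega_1,\hat\omega_2,\ldots$ and $x$). Then $\hat\mu$ is the unique $\hat F$-invariant probability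 measure with $\hat\mu\circ\Pi^{-1}=\mu$ (it exists and is ergodic); $\hat\nu$ is its marginal on $I^{\mathbb Z}$ and $\{\hat\mu_{\hat\omega}\}$ its system of conditional measures on $[0,1)$, i.e. $\int f\,d\hat\mu=\int_{I^{\mathbb Z}}\int_{[0,1)}f(\hat\omega,x)\,d\hat\mu_{\hat\omega}(x)\,d\hat\nu(\hat\omega)$ for $f\in L^1(\hat\mu)$. Fiber entropy. Let $\mathcal A=\{A\times[0,1):A\in\mathcal B_I^{\mathbb Z}\}$. For a partition $\mathcal P$ of $I^{\mathbb Z}\times[0,1)$ let $H_{\hat\mu}(\mathcal P|\mathcal A)=-\int\sum_{P\in\mathcal P}\mathbb E_{\hat\mu}(1_P|\mathcal A)\log\mathbb E_{\hat\mu}(1_P|\mathcal A)\,d\hat\mu$. Then $$h^{\mathrm{fib}}(\mathcal T)=\sup_{\mathcal P}\lim_{n\to\infty}\frac1nH_{\hat\mu}\Big(\bigvee_{k=0}^{n-1}\hat F^{-k}\mathcal P\,\Big|\,\mathcal A\Big),$$ the supremum over partitions $\mathcal P$ with $H_{\hat\mu}(\mathcal P|\mathcal A)<\infty$. One has $h^{\mathrm{fib}}(\mathcal T)\in[0,\infty)$. CLT-property. $\mathcal T$ satisfies the CLT-property (with constant $\sigma$) if there is some $\sigma>0$ such that for each $u\in\mathbb R$ $$\lim_{n\to\infty}\mu\Big(\Big\{(\omega,x)\in I^{\mathbb N}\times[0,1):\frac{-\log\lambda(\alpha_{\omega,n}(x))-nh^{\mathrm{fib}}(\mathcal T)}{\sigma\sqrt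 n}\le u\Big\}\Big)=\frac1{\sqrt{2\pi}}\int_{-\infty}^ue^{-t^2/2}\,dt.$$ NTFM. A number theoretic fibered map is a triple $(S,\tilde\mu,\mathcal E)$ where $S:[0,1)\to[0,1)$ is surjective, $\tilde\mu$ is a Borel measure and $\mathcal E$ is an at most countable interval partition of $[0,1)$ such that: (n1) $S|_E$ is continuous and strictly monotone for each $E\in\mathcal E$; (n2) $\tilde\mu$ is an ergodic $S$-invariant probability measure equivalent to $\lambda$ with density bounded and bounded away from zero; (n3) with $\mathcal E_n=\bigvee_{k=0}^{n-1}S^{-k}\mathcal E$, the $\sigma$-algebra generated by all sets in $\bigcup_n\mathcal E_n$ equals $\mathcal B$ up to $\lambda$-null sets; (n4) $H_{\tilde\mu}(\mathcal E)<\infty$. $\mathcal E_n(x)$ is the element of $\mathcal E_n$ containing $x$. Zero-property. $(S,\tilde\mu,\mathcal E)$ satisfies the zero-property if $\lim_{n\to\infty}\frac{-\log\lambda(\mathcal E_n(x))-nh_{\tilde\mu}(S)}{\sqrt n}=0$ for $\lambda$-a.e. $x$. *)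

(* Defs.v *)
From HB Require Import structures.
From mathcomp Require Import all_boot all_order all_algebra.
From mathcomp Require Import all_classical all_reals all_analysis.

Set Implicit Arguments.
Unset Strict Implicit.
Unset Printing Implicit Defensive.

Import Order.TTheory GRing.Theory Num.Theory.
Import numFieldNormedType.Exports.

Local Open Scope classical_set_scope.
Local Open Scope ring_scope.
Local Open Scope ereal_scope.

(** * Polish spaces *)

Definition compatible_complete_metric (R : realType) (T : topologicalType)
    (dist : T -> T -> R) : Prop :=
  [/\ forall x y, (0 <= dist x y)%R /\ (dist x y = 0%R <-> x = y),
      forall x y, dist x y = dist y x,
      forall x y z, (dist x z <= dist x y + dist y z)%R,
      forall x (A : set T), nbhs x A <->
        exists2 e : R, (0 < e)%R & [set y | (dist x y < e)%R] `<=` A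
    & forall u : nat -> T,
        (forall e : R, (0 < e)%R -> exists N : nat, forall m n : nat,
          (N <= m)%N -> (N <= n)%N -> (dist (u m) (u n) < e)%R) ->
        exists l : T, u @ \oo --> l].

Definition polish (R : realType) (T : topologicalType) : Prop :=
  (exists2 D : set T, countable D & dense D) /\
  (exists dist : T -> T -> R, compatible_complete_metric dist).

(** * The unit interval [0, 1) with its Borel sets and Lebesgue measure *)

Definition unitI (R : realType) : Type := set_type (`[0%R, 1%R[%classic : set R).

Section unitI_structure.
Variable R : realType.

HB.instance Definition _ :=
  Topological.copy (unitI R) (set_type (`[0%R, 1%R[%classic : set R)).

Definition unitI_val (x : unitI R) : R := set_val x.

Lemma unitI_subproof : (0%R : R) \in (`[0%R, 1%R[%classic : set R).
Proof. by rewrite inE /= in_itv /= lexx ltr01. Qed.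

HB.instance Definition _ :=
  isPointed.Build (unitI R) (exist _ (0%R : R) unitI_subproof).

(* the trace on [0, 1) of the Borel sets of R *)
HB.instance Definition _ := @isMeasurable.Build (preimage_display unitI_val)
  (unitI R) (g_sigma_algebra_preimage unitI_val)
  (@measurable0 _ (g_sigma_algebra_preimageType unitI_val))
  (@measurableC _ (g_sigma_algebra_preimageType unitI_val))
  (fun F => @bigcupT_measurable _ (g_sigma_algebra_preimageType unitI_val) F).

Definition lambda (A : set (unitI R)) : \bar R :=
  lebesgue_measure (unitI_val @` A).

Lemma unitI_val_inj : injective unitI_val.
Proof. exact: val_inj. Qed.

Lemma unitI_image_preimage (B : set R) :
  unitI_val @` (unitI_val @^-1` B) = `[0%R, 1%R[%classic `&` B.
Proof.
apply/seteqP; split => [_ [x Bx <-]|x [x01 Bx]].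
  by split => //; exact: (set_valP x).
by exists (exist _ x (mem_set x01)).
Qed.

Lemma measurable_unitI_image (A : set (unitI R)) :
  measurable A -> measurable (unitI_val @` A).
Proof.
by move=> [B mB <-]; rewrite setTI unitI_image_preimage; exact: measurableI.
Qed.

Let lambda0 : lambda set0 = 0.
Proof. by rewrite /lambda image_set0 measure0. Qed.

Let lambda_ge0 A : 0 <= lambda A.
Proof. exact: measure_ge0. Qed.

Let lambda_sigma_additive : semi_sigma_additive lambda.
Proof.
move=> F mF tF mUF; rewrite /lambda image_bigcup.
apply: measure_semi_sigma_additive.
- by move=> i; exact: measurable_unitI_image.
- apply/trivIsetP => i j _ _ ij.
  rewrite -subset0 => _ [[x Fx <-] [y Fy /unitI_val_inj yx]].
  rewrite yx in Fy.
  have : (F i `&` F j) x by split.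
  by have /trivIsetP/(_ i j Logic.I Logic.I ij) -> := tF.
- by rewrite -image_bigcup; exact: measurable_unitI_image.
Qed.

HB.instance Definition _ := isMeasure.Build _ _ _ lambda
  lambda0 lambda_ge0 lambda_sigma_additive.

Let lambda_setT : lambda setT = 1.
Proof.
rewrite /lambda -(preimage_setT unitI_val) unitI_image_preimage setIT.
by rewrite lebesgue_measure_itv /= lte_fin ltr01 oppr0 adde0.
Qed.

HB.instance Definition _ := Measure_isProbability.Build _ _ _ lambda
  lambda_setT.

End unitI_structure.
Arguments lambda {R}.
Arguments unitI_val {R}.

(** * Sequence spaces X^J with the product sigma-algebra *)

Definition coordinate_sets (J : Type) d (X : measurableType d) :
    set (set (J -> X)) :=
  [set A | exists j : J, exists2 B : set X,
     measurable B & A = [set w | B (w j)]].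

Notation seqs J X := (g_sigma_algebraType (@coordinate_sets J _ X)).

(** * Partitions and entropy *)

Section partitions.
Context d (X : measurableType d) (R : realType).
Implicit Types (m : {measure set X -> \bar R}) (P : set (set X)).

Definition is_partition m P : Prop :=
  [/\ countable P,
      forall A, P A -> measurable A,
      forall A B, P A -> P B -> A <> B -> m (A `&` B) = 0
    & m (~` \bigcup_(A in P) A) = 0].

Definition preimage_partition (f : X -> X) P : set (set X) :=
  [set f @^-1` A | A in P].

(* P 0 \vee ... \vee P (n - 1) *)
Definition join_partitions (n : nat) (P : nat -> set (set X)) : set (set X) :=
  [set A | exists2 c : nat -> set X,
     forall k, (k < n)%N -> P k (c k) & A = \bigcap_(k in `I_n) c k].

Definition iterated_join (f : X -> X) P (n : nat) : set (set X) :=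
  join_partitions n (fun k => preimage_partition (iter k f) P).

(* The element of P containing x.  When P is a partition modulo null sets the
   choice is forced outside a null set. *)
Definition cell P (x : X) : set X := xget set0 [set A | P A /\ A x].

(* ln 0 = 0, so that 0 log 0 = 0 *)
Definition entropy m P : \bar R :=
  \esum_(A in P) (- (fine (m A) * ln (fine (m A))))%:E.

Definition measure_preserving m (f : X -> X) : Prop :=
  measurable_fun setT f /\
  forall A, measurable A -> m (f @^-1` A) = m A.

Definition ergodic m (f : X -> X) : Prop :=
  forall A, measurable A -> f @^-1` A = A -> m A = 0 \/ m (~` A) = 0.

Definition equivalent_measures (m1 m2 : set X -> \bar R) : Prop :=
  forall A, measurable A -> m1 A = 0 <-> m2 A = 0.

(* the sigma-algebra generated by G equals the full one up to m-null sets *)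
Definition generates_mod_null m (G : set (set X)) : Prop :=
  (forall B, measurable B -> exists2 C, <<s G >> C & m.-negligible (B `+` C)) /\
  (forall C, <<s G >> C -> exists2 B, measurable B & m.-negligible (B `+` C)).

(* Kolmogorov-Sinai entropy *)
Definition ks_entropy m (f : X -> X) : \bar R :=
  ereal_sup
    [set limn (fun n => (n%:R^-1)%:E * entropy m (iterated_join f P n)) |
       P in [set P | is_partition m P /\ entropy m P < +oo]].

(** Conditioning on a sub-sigma-algebra G *)

Definition is_cond_prob m (G : set (set X)) (A : set X) (g : X -> R) : Prop :=
  [/\ forall B : set R, measurable B -> G (g @^-1` B),
      m.-integrable setT (EFin \o g)
    & forall C, G C -> \int[m]_(x in C) (g x)%:E = m (A `&` C)].

(* a version of E(1_A | G), determined up to an m-null set *)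
Definition cond_prob m (G : set (set X)) (A : set X) : X -> R :=
  xget (cst 0%R) [set g | is_cond_prob m G A g].

Definition cond_entropy m (G : set (set X)) P : \bar R :=
  \int[m]_x \esum_(A in P)
    (- (cond_prob m G A x * ln (cond_prob m G A x)))%:E.

End partitions.

(** * Functions on [0, 1) that are piecewise monotone *)

Section unitI_maps.
Variable R : realType.
Local Notation U := (unitI R).

Definition subinterval (A : set U) : Prop := is_interval (unitI_val @` A).

Definition strictly_monotone_on (A : set U) (f : U -> U) : Prop :=
  (forall x y, A x -> A y -> (unitI_val x < unitI_val y)%R ->
     (unitI_val (f x) < unitI_val (f y))%R) \/
  (forall x y, A x -> A y -> (unitI_val x < unitI_val y)%R ->
     (unitI_val (f y) < unitI_val (f x))%R).

End unitI_maps.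

(** * Random number systems *)

Section random_number_systems.
Context (R : realType) (I : ptopologicalType).
Local Notation U := (unitI R).
Local Notation BI := (g_sigma_algebraType (@open I)).

(* A point w of I^N is indexed from 0: w n is the coordinate omega_(n+1).
   A point of I^Z is indexed by its own coordinates. *)
Local Notation IN := (seqs nat BI).
Local Notation IZ := (seqs int BI).

Implicit Types (T : I -> U -> U) (alpha : I -> nat -> set U).

Definition left_shift (w : IN) : IN := fun n => w n.+1.

Definition skew T (z : IN * U) : IN * U :=
  (left_shift z.1, T (z.1 0%N) z.2).

Definition skew2 T (z : IZ * U) : IZ * U :=
  ((fun k : int => z.1 (k + 1)%R) : IZ, T (z.1 1%R) z.2).

Definition proj_IN (z : IZ * U) : IN * U :=
  ((fun n : nat => z.1 (n.+1%:Z)) : IN, z.2).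

(* T_omega^n *)
Fixpoint random_iter T (w : IN) (n : nat) (x : U) : U :=
  if n is k.+1 then T (w k) (random_iter T w k x) else x.

(* alpha_{omega, n} *)
Definition random_cylinders T alpha (w : IN) (n : nat) : set (set U) :=
  join_partitions n (fun k =>
    [set random_iter T w k @^-1` A | A in range (alpha (w k))]).

Definition Delta_set alpha (j : nat) : set (IN * U) :=
  [set z | alpha (z.1 0%N) j z.2].

(* The hat-mu of the skew product T and mu: such a measure exists and is unique
   because I is Polish. *)
Definition is_two_sided_extension T (mu : probability (IN * U)%type R)
    (muh : probability (IZ * U)%type R) : Prop :=
  measure_preserving muh (skew2 T) /\
  (forall A, measurable A -> muh (proj_IN @^-1` A) = mu A).

Definition base_marginal (muh : probability (IZ * U)%type R) :
    set IZ -> \bar R :=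
  pushforward muh fst.

Definition is_disintegration (muh : probability (IZ * U)%type R)
    (k : R.-pker IZ ~> U) : Prop :=
  forall f : IZ * U -> \bar R, muh.-integrable setT f ->
    \int[muh]_z f z = \int[base_marginal muh]_w \int[k w]_x f (w, x).

Record random_number_system (P : probability IN R) T
    (mu : probability (IN * U)%type R) alpha
    (muh : probability (IZ * U)%type R) : Prop := {
  rns_shift_nonsingular :
    forall A, measurable A -> P A = 0 -> P (left_shift @^-1` A) = 0 ;
  rns_measurable : forall i, measurable_fun setT (T i) ;
  rns_subinterval : forall i j, subinterval (alpha i j) ;
  rns_partition : forall i, is_partition lambda (range (alpha i)) ;
  (* the cells of alpha_i are disjoint as a family, not only as a set of sets *)
  rns_disjoint : forall i j1 j2, j1 <> j2 ->
    lambda (alpha i j1 `&` alpha i j2) = 0 ;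
  rns_invariant : measure_preserving mu (skew T) ;
  rns_jointly_measurable : measurable_fun setT (fun p : BI * U => T p.1 p.2) ;
  rns_branches : forall i j, strictly_monotone_on (alpha i j) (T i) /\
                     {within alpha i j, continuous (T i)} ;
  rns_Delta_measurable : forall j, measurable (Delta_set alpha j) ;
  rns_nonsingular : {ae P, forall w, forall B : set U, measurable B ->
            lambda B = 0 -> lambda (T (w 0%N) @^-1` B) = 0} ;
  rns_generating : {ae P, forall w, generates_mod_null lambda
            (\bigcup_n random_cylinders T alpha w n)} ;
  rns_ergodic_equivalent : ergodic mu (skew T) /\ equivalent_measures mu (P \x lambda) ;
  rns_finite_entropy : entropy mu (range (Delta_set alpha)) < +oo \/
         exists2 k : R.-pker IZ ~> U, is_disintegration muh k &
           \int[base_marginal muh]_w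
              entropy (k w) (range (alpha (w 1%R))) < +oo
}.

Definition base_sigma_algebra : set (set (IZ * U)) :=
  [set A `*` setT | A in (measurable : set (set IZ))].

Definition fiber_entropy T (muh : probability (IZ * U)%type R) : \bar R :=
  let H := cond_entropy muh base_sigma_algebra in
  ereal_sup
    [set limn (fun n => (n%:R^-1)%:E * H (iterated_join (skew2 T) Q n)) |
       Q in [set Q | is_partition muh Q /\ H Q < +oo]].

End random_number_systems.

(** * Central limit theorem property *)

Definition std_normal_cdf (R : realType) (u : R) : \bar R :=
  ((Num.sqrt (2 * pi))^-1)%:E *
  \int[lebesgue_measure]_(t in `]-oo, u]) (expR (- (t ^+ 2) / 2))%:E.

(* mu^* is the outer measure induced by mu.  It coincides with mu on
   measurable sets and with its completion on the sets that differ from a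
   measurable one by a null set, which is all one knows a priori about the
   event below since cells are only defined almost everywhere.  Likewise,
   cells of measure 0, for which ln 0 = 0, only concern a null set. *)
Definition clt_property (R : realType) (I : ptopologicalType)
    (T : I -> unitI R -> unitI R)
    (mu : probability
       (seqs nat (g_sigma_algebraType (@open I)) * unitI R)%type R)
    (alpha : I -> nat -> set (unitI R))
    (muh : probability
       (seqs int (g_sigma_algebraType (@open I)) * unitI R)%type R)
    (sigma : R) : Prop :=
  (0 < sigma)%R /\
  forall u : R,
    (fun n : nat => (mu^*)%mu [set z |
       ((- ln (fine (lambda (cell (random_cylinders T alpha z.1 n) z.2)))
         - n%:R * fine (fiber_entropy T muh)) / (sigma * Num.sqrt n%:R)
        <= u)%R])
    @ \oo --> std_normal_cdf u.

(** * Number theoretic fibered maps *)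

Section ntfm.
Variable R : realType.
Local Notation U := (unitI R).

Record ntfm (S : U -> U) (mut : probability U R) (E : set (set U)) :
    Prop := {
  ntfm_surjective : forall y, exists x, S x = y ;
  ntfm_partition : is_partition lambda E ;
  ntfm_subinterval : forall A, E A -> subinterval A ;
  ntfm_branches : forall A, E A ->
    {within A, continuous S} /\ strictly_monotone_on A S ;
  ntfm_invariant : measure_preserving mut S ;
  ntfm_ergodic : ergodic mut S ;
  ntfm_equivalent : equivalent_measures mut lambda ;
  ntfm_density : exists f : U -> R,
    [/\ measurable_fun setT f,
        exists a b : R, (0 < a)%R /\ forall x, (a <= f x <= b)%R
      & forall A, measurable A -> mut A = \int[lambda]_(x in A) (f x)%:E] ;
  ntfm_generating : generates_mod_null lambda (\bigcup_n iterated_join S E n) ;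
  ntfm_finite_entropy : entropy mut E < +oo
}.

Definition zero_property (S : U -> U) (mut : probability U R)
    (E : set (set U)) : Prop :=
  {ae lambda, forall x : U,
    (fun n : nat =>
      ((- ln (fine (lambda (cell (iterated_join S E n) x)))
        - n%:R * fine (ks_entropy mut S)) / Num.sqrt n%:R)%R)
    @ \oo --> (0%R : R)}.

End ntfm.

(* m_{T,S}(n, omega, x), with sup set0 = 0 *)
Definition matching_level (R : realType) (I : ptopologicalType)
    (T : I -> unitI R -> unitI R) (alpha : I -> nat -> set (unitI R))
    (S : unitI R -> unitI R) (E : set (set (unitI R)))
    (n : nat) (w : seqs nat (g_sigma_algebraType (@open I)))
    (x : unitI R) : \bar R :=
  maxe 0 (ereal_sup [set (m%:R)%:E | m in [set m : nat | (0 < m)%N /\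
    cell (random_cylinders T alpha w n) x `<=` cell (iterated_join S E m) x]]).

(* Main.v *)
Require Import Defs.
From mathcomp Require Import all_boot all_order all_algebra.
From mathcomp Require Import all_classical all_reals all_analysis.
From mathcomp Require Import measurable_realfun ring lra.
Import Order.TTheory GRing.Theory Num.Theory.
Import numFieldNormedType.Exports.
Set Implicit Arguments.
Unset Strict Implicit.
Unset Printing Implicit Defensive.
Local Open Scope classical_set_scope.
Local Open Scope ring_scope.
Local Open Scope ereal_scope.

(** The cylinder [alpha_{w,n}(x)] is an interval. If it contains [x] without
    being contained in the interval [E_m(x)], it reaches from [x] to an end of
    [E_m(x)]; so either [x] is within a fraction [exp (- d sqrt n)] of an end
    of [E_m(x)], which has Lebesgue measure at most [2 exp (- d sqrt n)], or
    [- log lambda (alpha_{w,n}(x)) <= - log lambda (E_m(x)) + d sqrt n]. Conversely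
    [alpha_{w,n}(x) `<=` E_m(x)] gives
    [- log lambda (E_m(x)) <= - log lambda (alpha_{w,n}(x))]. By the zero-property
    [- log lambda (E_m(x)) = m h(S) + o(sqrt m)] in measure, so that, with [m] the first
    integer above [n hfib / h(S) + u kappa sqrt n], the event on the matching
    level is squeezed between the CLT events for [u - rho] and [u + rho], up to
    sets of vanishing measure. These sets depend on [x] only, so they are
    estimated under [lambda] and absolute continuity transfers the estimate to
    [mu]; the exception is the set of points whose random cell has measure 0,
    where [ln 0 = 0]: as [0 < hfib] it is eventually contained in the CLT
    event for every [v], hence its measure vanishes.  As [mu^*] is monotone
    and subadditive, no measurability of the events is involved. *)

(** * Convergence of extended real sequences *)

Lemma cvge_near_bounds {R : realType} {f : nat -> \bar R} {l e : R} :
  f @ \oo --> l%:E -> (0 < e)%R ->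
  \forall n \near \oo, (l - e)%:E < f n < (l + e)%:E.
Proof.
move=> /fine_cvgP[ffin /cvgrPdist_lt fl] e0.
have fle := fl _ e0.
near=> n.
have fn : f n \is a fin_num by near: n.
have : (`|l - fine (f n)| < e)%R by near: n; exact: fle.
rewrite -(fineK fn) !lte_fin ltr_norml => /andP[h1 h2].
by apply/andP; split; lra.
Unshelve. all: by end_near. Qed.

Lemma cvge_squeeze_eps {R : realType} (f : nat -> \bar R) (l : R) :
  (forall e : R, (0 < e)%R ->
    \forall n \near \oo, (l - e)%:E <= f n <= (l + e)%:E) ->
  f @ \oo --> l%:E.
Proof.
move=> fP; apply/fine_cvgP; split.
  near=> n; have /andP[h1 h2] : (l - 1)%:E <= f n <= (l + 1)%:E.
    by near: n; exact: fP.
  rewrite fin_numE; apply/andP; split; apply/eqP => fn.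
    by rewrite fn in h1.
  by rewrite fn in h2.
apply/cvgrPdist_le => e e0; near=> n.
have : (l - e)%:E <= f n <= (l + e)%:E by near: n; exact: fP.
rewrite /=; case: (f n) => [r| |] //=; rewrite ?lee_fin => /andP[h1 h2].
by rewrite ler_norml; apply/andP; split; lra.
Unshelve. all: by end_near. Qed.

(** * The normal distribution function *)

(** As the measure of a half-line, the distribution function inherits subadditivity and continuity
    from above. *)
Lemma std_normal_cdfE (R : realType) (u : R) :
  std_normal_cdf u = normal_prob 0 1 `]-oo, u].
Proof.
rewrite /std_normal_cdf /normal_prob -ge0_integralZl//=.
- apply: eq_integral => x _.
  rewrite /normal_pdf oner_eq0 /normal_peak /normal_fun expr1n mul1r subr0.
  by rewrite EFinM mulr_natl.
- apply/measurable_EFinP; apply: measurableT_comp => //.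
  apply: measurable_funM => //; apply: measurableT_comp => //.

Qed.

Lemma std_normal_cdf_fin_num (R : realType) (u : R) :
  std_normal_cdf u \is a fin_num.
Proof. by rewrite std_normal_cdfE fin_num_measure. Qed.

(** The density never exceeds its peak. This prices the shift of [u] by [rho] in the final
    squeeze. *)
Lemma std_normal_cdf_lipschitz (R : realType) (u v : R) : (u <= v)%R ->
  std_normal_cdf v <= std_normal_cdf u + (normal_peak 1 * (v - u))%:E.
Proof.
move=> uv; rewrite !std_normal_cdfE.
have -> : `]-oo, v]%classic = `]-oo, u] `|` `]u, v] :> set R.
  by rewrite -itv_bndbnd_setU// bnd_simp.
apply: le_trans (measureU2 _ _ _) _ => //; rewrite leeD2l// /normal_prob.
have -> : (normal_peak 1 * (v - u))%:E =
    \int[lebesgue_measure]_(x in `]u, v]) (@normal_peak R 1)%:E.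
  rewrite integral_cst//= lebesgue_measure_itv/= lte_fin.
  move: uv; rewrite le_eqVlt => /orP[/eqP ->|uv]; last by rewrite uv EFinM.
  by rewrite ltxx subrr mulr0 mule0.
apply: ge0_le_integral => //=.
- by move=> x _; rewrite lee_fin normal_pdf_ge0.
- by apply/measurable_EFinP/measurable_funTS; exact: measurable_normal_pdf.
- by move=> x _; rewrite lee_fin normal_pdf_ub// oner_neq0.
Qed.

Lemma std_normal_cdf_small (R : realType) (e : R) : (0 < e)%R ->
  exists v : R, std_normal_cdf v < e%:E.
Proof.
move=> e0; pose F n : set R := `]-oo, (- n%:R)%R]%classic.
have mF n : measurable (F n) by exact: measurable_itv.
have : normal_prob 0 1 (F n) @[n --> \oo] --> (0 : \bar R).
  rewrite -(measure0 (@normal_prob R 0 1)).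
  have <- : \bigcap_n F n = set0.
    rewrite -subset0 => t /(_ (Num.truncn (- t)%R).+1 I).
    by rewrite /F/= in_itv/= leNgt => /negP; apply; rewrite ltrNl truncnS_gt.
  apply: (@nonincreasing_cvg_mu _ _ _ (normal_prob 0 1)) => //=.
  - by rewrite -ge0_fin_numE ?measure_ge0// fin_num_measure//; exact: mF.
  - exact: bigcapT_measurable.
  - move=> m n mn; apply/subsetPset => x; rewrite /F/= !in_itv => /le_trans; apply.
    by rewrite lerN2 ler_nat.
move=> /cvge_near_bounds - /(_ e e0)[n _ /(_ n (leqnn n)) /andP[_]].
by rewrite add0r => ne; exists (- n%:R)%R; rewrite std_normal_cdfE.
Qed.

(** * Sets of vanishing measure *)

Lemma lim_sup_set_cvg_null {d} {X : measurableType d} {R : realType}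
    (mu : probability X R) (F : (set X)^nat) :
  (forall k, measurable (F k)) -> mu (lim_sup_set F) = 0 ->
  mu \o F @ \oo --> 0.
Proof.
move=> mF F0; apply: (@squeeze_cvge _ _ _ _ (cst 0) _
    (fun n => mu (\bigcup_(k >= n) F k))); last 2 first.
- exact: cvg_cst.
- rewrite -F0; apply: lim_sup_set_cvg => //.
  by rewrite (le_lt_trans (probability_le1 _ _)) ?ltry//; exact: bigcup_measurable.
- apply: nearW => n /=; rewrite measure_ge0/= le_measure ?inE//.
  + exact: bigcup_measurable.
  + by move=> x Fx; exists n => //=.
Qed.

(** Otherwise [nu (F n) >= e] for arbitrarily large [n]; among these, pick sets with summable
    [mu]-measure. By Borel-Cantelli their limit superior is [mu]-null, hence [nu]-null, so their
    [nu]-measures tend to 0, which contradicts the bound [e]. *)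
Lemma cvg_measure_dominated {d} {X : measurableType d} {R : realType}
    (mu : {measure set X -> \bar R}) (nu : probability X R) (F : (set X)^nat) :
  (forall A, measurable A -> mu A = 0 -> nu A = 0) ->
  (forall k, measurable (F k)) -> mu \o F @ \oo --> 0 -> nu \o F @ \oo --> 0.
Proof.
move=> numu mF muF.
have finF n : nu (F n) \is a fin_num by rewrite fin_num_measure.
apply/fine_cvgP; split; first exact: nearW.
apply/cvgr0Pnorm_lt => e e0; apply: contrapT => nuF.
have sub k : exists n, mu (F n) <= (1 / (2 ^ k.+1)%:R)%:E /\ e%:E <= nu (F n).
  have k0 : (0 < 1 / (2 ^ k.+1)%:R :> R)%R by rewrite divr_gt0// ltr0n expn_gt0.
  have := cvge_near_bounds muF k0.
  rewrite sub0r add0r => -[N _ NP].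
  have [n Nn en] : exists2 n, (N <= n)%N & e%:E <= nu (F n).
    apply: contrapT => Nn; apply: nuF; exists N => // n /= Nn'.
    rewrite ger0_norm ?fine_ge0 ?measure_ge0// -lte_fin fineK//.
    by rewrite ltNge; apply/negP => en; apply: Nn; exists n.
  by exists n; split => //; have /andP[_ /ltW] := NP n Nn.
have [s sP] := choice sub.
have mFs k : measurable ((F \o s) k) by exact: mF.
have /(lim_sup_set_cvg0 mFs)/numu nus0 : \sum_(k <oo) mu ((F \o s) k) < +oo.
  apply: (@le_lt_trans _ _ (\sum_(k <oo) (1 / (2 ^ k.+1)%:R)%:E)).
    by apply: lee_nneseries => // k _; exact: (sP k).1.
  by apply: le_lt_trans (epsilon_trick0 _ _) _; rewrite ?ltry.
have : nu \o (F \o s) @ \oo --> 0.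
  apply: lim_sup_set_cvg_null => //; apply: nus0.
  by apply: bigcap_measurable => // k _; exact: bigcup_measurable.
move=> /cvge_to_ge - /(_ e%:E) H.
suff : e%:E <= 0 by rewrite lee_fin leNgt e0.
by apply: H; apply: nearW => k; exact: (sP k).2.
Qed.

(** * Subintervals of the unit interval *)

Section unit_intervals.
Variable R : realType.
Local Notation U := (unitI R).
Implicit Types (A C : set U) (x : U).

Lemma subinterval_measurable A : subinterval A -> measurable A.
Proof.
move=> iA; exists (unitI_val @` A); first exact: is_interval_measurable.
rewrite setTI; apply/seteqP; split => [x [y Ay /unitI_val_inj <-]|x Ax] //.
by exists x.
Qed.

Lemma unitI_valP x : (0 <= unitI_val x < 1)%R.
Proof. by have := set_valP x; rewrite /= in_itv. Qed.

Definition lower_end A : R := inf (unitI_val @` A).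
Definition upper_end A : R := sup (unitI_val @` A).

Lemma lower_end_le A x : A x -> (lower_end A <= unitI_val x)%R.
Proof.
move=> Ax; apply: ge_inf; last by exists x.
by exists 0%R => _ [y _ <-]; have /andP[] := unitI_valP y.
Qed.

Lemma upper_end_ge A x : A x -> (unitI_val x <= upper_end A)%R.
Proof.
move=> Ax; apply: ub_le_sup; last by exists x.
by exists 1%R => _ [y _ <-]; have /andP[_ /ltW] := unitI_valP y.
Qed.

Lemma lower_end_ge A x (r : R) : A x ->
  (forall y, A y -> r <= unitI_val y)%R -> (r <= lower_end A)%R.
Proof.
move=> Ax rA; apply: lb_le_inf; first by exists (unitI_val x), x.
by move=> _ [y Ay <-]; exact: rA.
Qed.

Lemma upper_end_le A x (r : R) : A x ->
  (forall y, A y -> unitI_val y <= r)%R -> (upper_end A <= r)%R.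
Proof.
move=> Ax rA; apply: ge_sup; first by exists (unitI_val x), x.
by move=> _ [y Ay <-]; exact: rA.
Qed.

Lemma subinterval_mem A x y z : subinterval A -> A x -> A z ->
  (unitI_val x <= unitI_val y <= unitI_val z)%R -> A y.
Proof.
move=> iA Ax Az xyz.
have [] := iA (unitI_val x) (unitI_val z) _ _ _ xyz; [by exists x|by exists z|].
by move=> t At /unitI_val_inj <-.
Qed.

Lemma lambda_itv_le A x y : subinterval A -> A x -> A y ->
  (unitI_val x <= unitI_val y)%R ->
  ((unitI_val y - unitI_val x)%:E <= lambda A)%E.
Proof.
move=> iA Ax Ay xy; rewrite /lambda.
have -> : (unitI_val y - unitI_val x)%:E =
    lebesgue_measure `[unitI_val x, unitI_val y]%classic.
  rewrite lebesgue_measure_itv/= lte_fin.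
  move: xy; rewrite le_eqVlt => /orP[/eqP ->|->//].
  by rewrite ltxx subrr.
apply: le_measure; rewrite ?inE//.
- exact: is_interval_measurable.
- move=> z /=; rewrite in_itv/= => /(iA _ _ _ _); apply; [by exists x|by exists y].
Qed.

Lemma lambda_subinterval A x : subinterval A -> A x ->
  lambda A = (upper_end A - lower_end A)%:E.
Proof.
move=> iA Ax; apply/eqP; rewrite eq_le; apply/andP; split.
  have -> : (upper_end A - lower_end A)%:E =
      lebesgue_measure `[lower_end A, upper_end A]%classic.
    have : (lower_end A <= upper_end A)%R.
      by rewrite (le_trans (lower_end_le Ax))// upper_end_ge.
    rewrite lebesgue_measure_itv/= lte_fin le_eqVlt => /orP[/eqP ->|->//].
    by rewrite ltxx subrr.
  apply: le_measure; rewrite ?inE//; first exact: is_interval_measurable.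
  move=> _ [y Ay <-] /=; rewrite in_itv/=.
  by rewrite lower_end_le// upper_end_ge.
have fA : lambda A \is a fin_num.
  by rewrite fin_num_measure//; exact: subinterval_measurable.
(* Any two points of [A] are at most [lambda A] apart; pass to the infimum over one and the supremum
   over the other. *)
rewrite -(fineK fA) lee_fin lerBlDr -lerBlDl.
apply: (@lower_end_ge A x) => // y Ay; rewrite lerBlDr.
apply: (@upper_end_le A x) => // z Az; rewrite -lerBlDl.
rewrite -lee_fin fineK//.
have [yz|/ltW zy] := leP (unitI_val y) (unitI_val z).
  exact: lambda_itv_le.
by rewrite (le_trans _ (measure_ge0 lambda A))// lee_fin subr_le0.
Qed.

(* The bounds are weak so that every point of an interval of measure 0 is
   within any fraction of its ends. *)
Definition near_end (e : R) A : set U := [set x | A x /\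
  (upper_end A - unitI_val x <= e * fine (lambda A) \/
   unitI_val x - lower_end A <= e * fine (lambda A))%R].

Lemma near_endE (e : R) A : near_end e A = A `&` unitI_val @^-1`
  (`[upper_end A - e * fine (lambda A), +oo[ `|`
   `]-oo, lower_end A + e * fine (lambda A)])%R.
Proof.
apply/seteqP; split => x [Ax]; rewrite /= !in_itv/= ?andbT => -[h|h]; split => //;
  by [left; lra|right; lra].
Qed.

Lemma unitI_val_measurable (B : set R) :
  measurable B -> measurable (unitI_val @^-1` B).
Proof. by move=> mB; exists B => //; rewrite setTI. Qed.

Lemma near_end_measurable (e : R) A : subinterval A -> measurable (near_end e A).
Proof.
move=> iA; rewrite near_endE; apply: measurableI.
  exact: subinterval_measurable.
by apply: unitI_val_measurable; exact: measurableU.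
Qed.

(** The factor 2 counts the two end pieces, each of length [e * lambda A]. *)
Lemma lambda_near_end (e : R) A : (0 <= e)%R -> subinterval A ->
  lambda (near_end e A) <= (2 * e)%:E * lambda A.
Proof.
move=> e0 iA; have [->|/set0P[x Ax]] := eqVneq A set0.
  suff -> : near_end e set0 = set0 by rewrite measure0 mule0.
  by rewrite near_endE set0I.
have fA : lambda A \is a fin_num.
  by rewrite fin_num_measure//; exact: subinterval_measurable.
pose l := fine (lambda A).
have l0 : (0 <= e * l)%R by rewrite mulr_ge0// fine_ge0// measure_ge0.
have sub : unitI_val @` near_end e A `<=`
    (`[upper_end A - e * l, upper_end A] `|`
     `[lower_end A, lower_end A + e * l])%R%classic.
  move=> _ [y [Ay]] + <- /=; rewrite !in_itv/= lower_end_le// upper_end_ge// andbT.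
  by rewrite -/l => -[h|h]; [left|right]; lra.
have le1 : lambda (near_end e A) <= lebesgue_measure
    (`[upper_end A - e * l, upper_end A] `|`
     `[lower_end A, lower_end A + e * l])%R%classic.
  rewrite /lambda; apply: le_measure => //; rewrite ?inE.
  - by apply: measurable_unitI_image; exact: near_end_measurable.
  - by apply: (@measurableU _ (measurableTypeR R)).
apply: (le_trans le1).
apply: (@le_trans _ _
    (lebesgue_measure `[(upper_end A - e * l)%R, upper_end A]%classic +
     lebesgue_measure `[lower_end A, (lower_end A + e * l)%R]%classic)).
  exact: measureU2.
rewrite !lebesgue_measure_itv/= !lte_fin -[X in _ * X]fineK//.
have [l00|l00] := eqVneq (e * l)%R 0%R.
  by rewrite l00 subr0 addr0 !ltxx adde0 -EFinM -mulrA [X in (_ * X)%R]l00 mulr0.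
have lp : (0 < e * l)%R by rewrite lt_neqAle eq_sym l00.
rewrite gtrBl ltrDl lp -!EFinB -EFinD -EFinM lee_fin.
rewrite -/l; lra.
Qed.

(** A point [y] of [C] outside the interval [A] lies beyond one end of [A], so [C] covers the
    stretch from [x] to that end. Being strictly away from both ends also forces [A] to have
    positive length. *)
Lemma near_end_escape (e : R) A C x : (0 <= e)%R ->
  subinterval A -> subinterval C -> A x -> C x -> ~ near_end e A x ->
  ~ (C `<=` A) ->
  (0 < fine (lambda A))%R /\ (e * fine (lambda A) < fine (lambda C))%R.
Proof.
move=> e0 iA iC Ax Cx nx CA.
have lA : fine (lambda A) = (upper_end A - lower_end A)%R.
  by rewrite (lambda_subinterval iA Ax).
have fC : lambda C \is a fin_num.
  by rewrite fin_num_measure//; exact: subinterval_measurable.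
have [h1 h2] : (e * fine (lambda A) < upper_end A - unitI_val x)%R /\
    (e * fine (lambda A) < unitI_val x - lower_end A)%R.
  by split; rewrite ltNge; apply/negP => h; apply: nx; split => //; [left|right].
have l0 : (0 <= e * fine (lambda A))%R.
  by rewrite mulr_ge0// fine_ge0// measure_ge0.
split; first by rewrite lA; have := lower_end_le Ax; lra.
have [y [Cy Ay]] : exists y, C y /\ ~ A y.
  by apply: contrapT => H; apply: CA => y Cy; apply: contrapT => Ay; apply: H; exists y.
have [xy|/ltW yx] := leP (unitI_val x) (unitI_val y).
- apply: (lt_le_trans h1).
  rewrite -lee_fin fineK//; apply: le_trans (lambda_itv_le iC Cx Cy xy).
  rewrite lee_fin lerD2r; apply: (@upper_end_le A x) => // z Az.
  rewrite leNgt; apply/negP => /ltW yz; apply: Ay.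
  by apply: (@subinterval_mem _ x y z) => //; rewrite xy.
- apply: (lt_le_trans h2).
  rewrite -lee_fin fineK//; apply: le_trans (lambda_itv_le iC Cy Cx yx).
  rewrite lee_fin lerD2l lerN2; apply: (@lower_end_ge A x) => // z Az.
  rewrite leNgt; apply/negP => /ltW zy; apply: Ay.
  by apply: (@subinterval_mem _ z y x) => //; rewrite zy.
Qed.

End unit_intervals.

(** * Countable unions over partitions modulo null sets *)

Section measure_partitions.
Context {d} {X : measurableType d} {R : realType}.
Implicit Types (m : {measure set X -> \bar R}) (P : set (set X)).

Lemma measurable_bigcup_countable P (f : set X -> set X) : countable P ->
  (forall A, P A -> measurable (f A)) -> measurable (\bigcup_(A in P) f A).
Proof.
move=> /pfcard_geP[->|[e]] mf; first by rewrite bigcup_set0.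
rewrite -(image_eq e) bigcup_image; apply: bigcupT_measurable => n.
by apply: mf; apply: funS.
Qed.

(** The elements of [P] overlap in null sets only, so making them disjoint costs no measure and
    their measures add up to at most [m setT]. *)
Lemma measure_bigcup_le m (c : R) P (f : set X -> set X) : (0 <= c)%R ->
  countable P -> (forall A, P A -> measurable A) ->
  (forall A B, P A -> P B -> A <> B -> m (A `&` B) = 0) ->
  (forall A, P A -> measurable (f A) /\ m (f A) <= c%:E * m A) ->
  m (\bigcup_(A in P) f A) <= c%:E * m setT.
Proof.
move=> c0 /pfcard_geP[->|[e]] mP dP fP.
  by rewrite bigcup_set0 measure0 mule_ge0// ?lee_fin// measure_ge0.
have Pe n : P (e n) by exact: funS.
have me n : measurable (e n) by exact: mP.
rewrite -(image_eq e) bigcup_image.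
(* only the first occurrence of each set in the enumeration is kept *)
pose new n := forall k, (k < n)%N -> e k <> e n.
pose g n := if `[< new n >] then f (e n) else set0.
have mg n : measurable (g n) by rewrite /g; case: asboolP => // _; exact: (fP _ (Pe n)).1.
have -> : \bigcup_n f (e n) = \bigcup_n g n.
  apply/seteqP; split => [x [n _ fx]|x [n _]]; last first.
    by rewrite /g; case: asboolP => // _ fx; exists n.
  have ex : exists k, `[< e k = e n >] by exists n; apply/asboolP.
  have [k /asboolP kn kmin] := ex_minnP ex.
  exists k => //; rewrite /g; case: asboolP => [_|]; first by rewrite kn.
  move=> nk; exfalso; apply: nk => j jk ejk.
  have /kmin : `[< e j = e n >] by apply/asboolP; rewrite ejk.
  by rewrite leqNgt jk.
have mD n : measurable (seqDU e n).
  by apply: measurableD => //; exact: bigsetU_measurable.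
(* A first occurrence meets each earlier set in a null set, so [seqDU e n] keeps the full measure of
   [e n]. *)
have gD n : m (g n) <= c%:E * m (seqDU e n).
  rewrite /g; case: asboolP => [newn|_]; last first.
    by rewrite measure0 mule_ge0// ?lee_fin// measure_ge0.
  apply: le_trans (fP _ (Pe n)).2 _; rewrite lee_wpmul2l ?lee_fin//.
  have mU : measurable (\big[setU/set0]_(k < n) e k) by exact: bigsetU_measurable.
  rewrite (measureDI m (me n) mU) -[leRHS]adde0 leeD2l// big_distrr/=.
  have mI k : (k < n)%N -> measurable (e n `&` e k) by move=> _; exact: measurableI.
  apply: le_trans (Boole_inequality m mI) _.
  by rewrite big1// => k _; apply: dP => // /esym; exact: newn.
apply: (@le_trans _ _ (\sum_(n <oo) m (g n))).
  by apply: measure_sigma_subadditive => //; exact: bigcupT_measurable.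
apply: (@le_trans _ _ (\sum_(n <oo) c%:E * m (seqDU e n))).
  by apply: lee_nneseries => // n _; exact: gD.
rewrite nneseriesZl// lee_wpmul2l ?lee_fin//.
rewrite -measure_semi_bigcup//.
- by apply: le_measure; rewrite ?inE//; exact: bigcupT_measurable.
- exact: bigcupT_measurable.
Qed.

End measure_partitions.

(** * Cylinders *)

Section join_intervals.
Variable R : realType.
Local Notation U := (unitI R).
Variables (f : nat -> U -> U) (g : nat -> U -> U) (P : nat -> set (set U)).
Hypothesis g0 : forall x, g 0 x = x.
Hypothesis gS : forall n x, g n.+1 x = f n (g n x).
Hypothesis fmono : forall n A, P n A -> strictly_monotone_on A (f n).
Hypothesis Pitv : forall n A, P n A -> subinterval A.

(** Stated for abstract [f] and [g] to serve both the random iterates and the iterates of [S]. *)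
Lemma join_partitions_subinterval n A :
  join_partitions n (fun k => [set g k @^-1` B | B in P k]) A -> subinterval A.
Proof.
move=> [c cP ->] {A}.
(* The induction carries monotonicity of [g n] along: it makes the next preimage of an interval, cut
   with the cylinder, an interval again. *)
suff [] : subinterval (\bigcap_(k in `I_n) c k) /\
    strictly_monotone_on (\bigcap_(k in `I_n) c k) (g n) by [].
elim: n cP => [|n IH] cP.
  rewrite II0 bigcap_set0; split; last by left => x y _ _; rewrite !g0.
  have -> : [set: U] = unitI_val @^-1` `[0%R, 1%R[%classic.
    by apply/esym; rewrite -subTset => x _; rewrite /= in_itv/= unitI_valP.
  rewrite /subinterval unitI_image_preimage setIid; exact: interval_is_interval.
have [iC mC] : subinterval (\bigcap_(k in `I_n) c k) /\
    strictly_monotone_on (\bigcap_(k in `I_n) c k) (g n).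
  by apply: IH => k kn; apply: cP; rewrite ltnS ltnW.
have [B PB cB] := cP n (ltnSn n).
have iB := Pitv PB.
have mB := fmono PB.
rewrite bigcap_mkord big_ord_recr/= -bigcap_mkord -cB.
set C := \bigcap_(k in `I_n) c k in iC mC *.
split.
- move=> _ _ [x [Cx Bx] <-] [z [Cz Bz] <-] r /andP[xr rz].
  have [y Cy yr] : (unitI_val @` C) r by apply: (iC (unitI_val x) (unitI_val z));
    [exists x|exists z|rewrite xr].
  exists y => //; split => //; rewrite /preimage/=.
  move: xr rz; rewrite -yr !le_eqVlt.
  move=> /orP[/eqP /unitI_val_inj <-//|xy] /orP[/eqP /unitI_val_inj ->//|yz].
  case: mC => mC.
  + by apply: (subinterval_mem iB Bx Bz); rewrite !ltW// mC.
  + by apply: (subinterval_mem iB Bz Bx); rewrite !ltW// mC.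
- case: mB => mB; case: mC => mC.
  + by left => x y [Cx Bx] [Cy By] xy; rewrite !gS; apply: mB => //; exact: mC.
  + by right => x y [Cx Bx] [Cy By] xy; rewrite !gS; apply: mB => //; exact: mC.
  + by right => x y [Cx Bx] [Cy By] xy; rewrite !gS; apply: mB => //; exact: mC.
  + by left => x y [Cx Bx] [Cy By] xy; rewrite !gS; apply: mB => //; exact: mC.
Qed.

End join_intervals.

Section cells.
Context {d} {X : measurableType d}.
Implicit Types (f : X -> X) (P : set (set X)).

(** At such points the choice made by [cell] is forced. *)
Definition unique_cell P (x : X) : Prop :=
  exists A, [/\ P A, A x & forall B, P B -> B x -> B = A].

Lemma cellP P (x : X) : unique_cell P x ->
  [/\ P (cell P x), cell P x x & forall B, P B -> B x -> B = cell P x].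
Proof.
move=> [A [PA Ax uA]].
have -> : cell P x = A.
  by apply: xget_unique => // B [PB Bx]; exact: uA.
by [].
Qed.

Lemma unique_cell_iterated_join f P (x : X) n :
  (forall k, (k < n)%N -> unique_cell P (iter k f x)) ->
  unique_cell (iterated_join f P n) x /\
  cell (iterated_join f P n) x =
    \bigcap_(k in `I_n) iter k f @^-1` cell P (iter k f x).
Proof.
move=> uP; set A := \bigcap_(k in _) _.
have JA : iterated_join f P n A.
  exists (fun k => iter k f @^-1` cell P (iter k f x)) => // k kn.
  by exists (cell P (iter k f x)) => //; have [] := cellP (uP k kn).
have Ax : A x by move=> k kn; have [] := cellP (uP k kn).
have uA B : iterated_join f P n B -> B x -> B = A.
  move=> [c cP ->] cx; apply: eq_bigcapr => k kn.
  have [C PC Cc] := cP k kn; rewrite -Cc; congr (_ @^-1` _).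
  have [_ _] := cellP (uP k kn); apply => //.
  by have := cx k kn; rewrite -Cc.
by split; [exists A|apply: xget_unique => // B [JB Bx]; exact: uA].
Qed.

Lemma iterated_join_countable f P n : countable P -> countable (iterated_join f P n).
Proof.
move=> cP; elim: n => [|n IH].
  apply: (@sub_countable _ _ _ [set setT]); last exact: countable1.
  by apply: subset_card_le => A [c _ ->]; rewrite II0 bigcap_set0.
have := @bigcup_countable _ _ P (fun B => [set A `&` (iter n f @^-1` B) |
  A in iterated_join f P n]) cP.
move=> H; apply: sub_countable (H _); last first.
  by move=> B _; exact: sub_countable (card_image_le _ _) IH.
apply: subset_card_le => A [c cP' ->].
have [B PB Bc] := cP' n (ltnSn n).
exists B => //; exists (\bigcap_(k in `I_n) c k).
  by exists c => // k kn; apply: cP'; rewrite ltnS ltnW.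
by rewrite Bc [RHS]bigcap_mkord big_ord_recr/= -bigcap_mkord.
Qed.

End cells.

(** * Cylinders of a number theoretic fibered map *)

Section ntfm_cells.
Variables (R : realType) (S : unitI R -> unitI R) (mut : probability (unitI R) R).
Variable E : set (set (unitI R)).
Hypothesis ntfmS : ntfm S mut E.
Local Notation U := (unitI R).
Local Notation En := (iterated_join S E).

(** The whole orbit is required, so that one null set serves the cylinders of all levels. *)
Definition regular (x : U) : Prop := forall k, unique_cell E (iter k S x).

(** [S] preserves [mut], which has the same null sets as [lambda]. *)
Lemma iter_negligible (A : set U) k :
  lambda.-negligible A -> lambda.-negligible (iter k S @^-1` A).
Proof.
elim: k A => [|k IH] A nA; first by [].
rewrite (_ : _ @^-1` _ = iter k S @^-1` (S @^-1` A)); last by [].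
apply: IH; case: nA => B [mB B0 AB].
have [mS invS] := ntfm_invariant ntfmS.
have mSB : measurable (S @^-1` B) by rewrite -[X in measurable X]setTI; exact: mS.
exists (S @^-1` B); split => //; last by move=> x /AB.
by apply/(ntfm_equivalent ntfmS) => //; rewrite invS//; apply/(ntfm_equivalent ntfmS).
Qed.

Lemma not_unique_cell_negligible : lambda.-negligible [set x | ~ unique_cell E x].
Proof.
have [cE mE dE covE] := ntfm_partition ntfmS.
have ncov : lambda.-negligible (~` \bigcup_(A in E) A).
  apply/negligibleP => //; apply: measurableC.
  exact: (@measurable_bigcup_countable _ _ E id).
have /pfcard_geP[E0|[e]] := cE.
  by apply: negligibleS ncov => x _ [A]; rewrite E0.
have Ee n : E (e n) by exact: funS.
(* The enumeration [e] may repeat a set, hence the condition [e i <> e j] on the overlaps. *)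
have novl : lambda.-negligible
    (\bigcup_i \bigcup_j [set x | e i <> e j /\ (e i `&` e j) x]).
  apply: negligible_bigcup => i; apply: negligible_bigcup => j.
  have [eij|eij] := pselect (e i = e j).
    by apply: negligibleS (negligible_set0 _) => x [].
  exists (e i `&` e j); split; [|exact: dE|by move=> x []].
  by apply: measurableI; exact: mE.
apply: negligibleS (negligibleU ncov novl) => x nx.
have [[A EA Ax]|] := pselect ((\bigcup_(A in E) A) x); last by left.
right; apply: contrapT => nov; apply: nx; exists A; split => // B EB Bx.
apply: contrapT => BA; apply: nov.
have [i _ eiA] : range e A by rewrite image_eq.
have [j _ ejB] : range e B by rewrite image_eq.
by exists j => //; exists i => //=; rewrite eiA ejB.
Qed.

Lemma not_regular_negligible : lambda.-negligible [set x | ~ regular x].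
Proof.
apply: (@negligibleS _ _ _ lambda
    (\bigcup_k iter k S @^-1` [set x | ~ unique_cell E x])).
  move=> x /existsNP[k nx]; by exists k.
apply: negligible_bigcup => k.
exact/iter_negligible/not_unique_cell_negligible.
Qed.

Lemma regular_unique_cell x n : regular x -> unique_cell (En n) x.
Proof. by move=> rx; have [] := unique_cell_iterated_join (n:=n) (fun k _ => rx k). Qed.

Lemma regular_cell_nested x m n : regular x -> (m <= n)%N ->
  cell (En n) x `<=` cell (En m) x.
Proof.
move=> rx mn.
have [_ ->] := unique_cell_iterated_join (n:=m) (fun k _ => rx k).
have [_ ->] := unique_cell_iterated_join (n:=n) (fun k _ => rx k).
by move=> y ny k km; apply: ny; exact: leq_trans mn.
Qed.

Lemma ntfm_cylinder_subinterval n (A : set U) : En n A -> subinterval A.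
Proof.
move=> EA; apply: (@join_partitions_subinterval _ (fun=> S) (fun k => iter k S)
  (fun=> E) _ _ _ _ n) => //.
- by move=> _ B /(ntfm_branches ntfmS)[].
- by move=> _ B /(ntfm_subinterval ntfmS).
Qed.

Lemma ntfm_cylinder_measurable n (A : set U) : En n A -> measurable A.
Proof. by move=> /ntfm_cylinder_subinterval; exact: subinterval_measurable. Qed.

Lemma ntfm_cylinder_countable n : countable (En n).
Proof. by apply: iterated_join_countable; have [] := ntfm_partition ntfmS. Qed.

(** No regular point lies in two different cylinders of the same level. *)
Lemma ntfm_cylinder_disjoint n (A B : set U) : En n A -> En n B -> A <> B ->
  lambda (A `&` B) = 0.
Proof.
move=> EA EB AB; apply/negligibleP.
  by apply: measurableI; [exact: ntfm_cylinder_measurable EA|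
    exact: ntfm_cylinder_measurable EB].
apply: negligibleS not_regular_negligible => x [Ax Bx] rx; apply: AB.
have [_ _ uC] := cellP (regular_unique_cell n rx).
by rewrite (uC A)// (uC B).
Qed.

Definition near_ends (e : R) n : set U := \bigcup_(A in En n) near_end e A.

Lemma near_ends_measurable e n : measurable (near_ends e n).
Proof.
apply: measurable_bigcup_countable; first exact: ntfm_cylinder_countable.
by move=> A /ntfm_cylinder_subinterval; exact: near_end_measurable.
Qed.

(** The bound is uniform in the level, which later varies together with the fraction [e]. *)
Lemma lambda_near_ends e n : (0 <= e)%R -> lambda (near_ends e n) <= (2 * e)%:E.
Proof.
move=> e0; rewrite -[leRHS]mule1 -(probability_setT (lambda : probability U R)).
apply: measure_bigcup_le.
- by rewrite mulr_ge0.
- exact: ntfm_cylinder_countable.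
- by move=> A; exact: ntfm_cylinder_measurable.
- by move=> A B; exact: ntfm_cylinder_disjoint.
- move=> A /ntfm_cylinder_subinterval iA; split; first exact: near_end_measurable.
  exact: lambda_near_end.
Qed.

Definition information_gap (n : nat) (A : set U) : R :=
  (- ln (fine (lambda A)) - n%:R * fine (ks_entropy mut S))%R.

(** A countable union of cylinders, hence measurable, unlike a condition on the chosen [cell]; at
    regular points the two agree. *)
Definition far_cells (e : R) n : set U :=
  \bigcup_(A in [set A | En n A /\
    (e * Num.sqrt n%:R < `|information_gap n A|)%R]) A.

Lemma far_cells_measurable e n : measurable (far_cells e n).
Proof.
apply: (@measurable_bigcup_countable _ _ _ id).
  apply: sub_countable (ntfm_cylinder_countable n).
  by apply: subset_card_le => A [].
by move=> A [/ntfm_cylinder_measurable].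
Qed.

Lemma lim_sup_far_cells e : (0 < e)%R -> zero_property S mut E ->
  lambda (lim_sup_set (far_cells e)) = 0.
Proof.
move=> e0 zeroS; apply/negligibleP.
  apply: bigcapT_measurable => k; apply: bigcup_measurable => j _.
  exact: far_cells_measurable.
apply: negligibleS (negligibleU not_regular_negligible zeroS) => x far.
have [rx|] := pselect (regular x); last by left.
right => /cvgr0Pnorm_lt - /(_ e e0)[N _ NP].
(* Starting from [N.+1] makes [n] positive, so that [sqrt n] can be divided by. *)
have [n /= Nn [A [EA gapA] Ax]] := far N.+1 I.
have [_ _ uC] := cellP (regular_unique_cell n rx).
have := NP n (ltnW Nn); rewrite -(uC A EA Ax) -/(information_gap n A).
have sn : (0 < Num.sqrt n%:R :> R)%R by rewrite sqrtr_gt0 ltr0n (leq_trans _ Nn).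
by rewrite normrM normfV (gtr0_norm sn) ltr_pdivrMr// ltNge (ltW gapA).
Qed.

Lemma not_far_cells e n x : regular x -> ~ far_cells e n x ->
  (`|information_gap n (cell (En n) x)| <= e * Num.sqrt n%:R)%R.
Proof.
move=> rx nx; rewrite leNgt; apply/negP => h; apply: nx.
have [EC Cx _] := cellP (regular_unique_cell n rx).
by exists (cell (En n) x).
Qed.

Lemma not_near_ends e n x : regular x -> ~ near_ends e n x ->
  ~ near_end e (cell (En n) x) x.
Proof.
move=> rx nx h; apply: nx.
have [EC _ _] := cellP (regular_unique_cell n rx).
by exists (cell (En n) x).
Qed.

End ntfm_cells.

(** * Comparison of the two families of cylinders *)

Section outer_probability.
Context {d} {X : measurableType d} {R : realType} (mu : probability X R).

Lemma mu_ext_fin_num (A : set X) : (mu^*)%mu A \is a fin_num.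
Proof.
rewrite ge0_fin_numE ?mu_ext_ge0//.
apply: le_lt_trans (le_mu_ext mu (@subsetT _ A)) _.
by rewrite measurable_mu_extE// -ge0_fin_numE// fin_num_measure.
Qed.

Lemma le_fine_mu_ext (A B : set X) : A `<=` B ->
  (fine ((mu^*)%mu A) <= fine ((mu^*)%mu B))%R.
Proof. by move=> AB; rewrite fine_le ?mu_ext_fin_num// le_mu_ext. Qed.

Lemma fine_mu_extU (A B : set X) :
  (fine ((mu^*)%mu (A `|` B)) <= fine ((mu^*)%mu A) + fine ((mu^*)%mu B))%R.
Proof.
rewrite -fineD ?mu_ext_fin_num// fine_le ?fin_numD ?mu_ext_fin_num//.
exact: outer_measureU2.
Qed.

Lemma mu_ext_negligible (A : set X) : mu.-negligible A -> (mu^*)%mu A = 0.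
Proof.
move=> [B [mB B0 AB]]; apply/eqP; rewrite eq_le mu_ext_ge0// andbT.
by rewrite -B0 -measurable_mu_extE// le_mu_ext.
Qed.

End outer_probability.

(** * Random cells against the cylinders of [S], and the exceptional sets *)

Section matching.
Variables (R : realType) (I : ptopologicalType).
Local Notation U := (unitI R).
Local Notation IN := (seqs nat (g_sigma_algebraType (@open I))).
Variables (P : probability IN R) (T : I -> U -> U) (mu : probability (IN * U)%type R).
Variable alpha : I -> nat -> set U.
Variables (S : U -> U) (mut : probability U R) (E : set (set U)).
Hypothesis alpha_monotone : forall i j, strictly_monotone_on (alpha i j) (T i).
Hypothesis alpha_subinterval : forall i j, subinterval (alpha i j).
Hypothesis mu_dominated :
  forall A, measurable A -> (P \x lambda) A = 0 -> mu A = 0.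
Hypothesis ntfmS : ntfm S mut E.
Local Notation En := (iterated_join S E).
Local Notation hS := (fine (ks_entropy mut S)).

Local Notation random_cell n w x := (cell (random_cylinders T alpha w n) x).
Local Notation neg_log_cell n w x := (- ln (fine (lambda (random_cell n w x))))%R.

(** [set0] is the default of [cell] when no random cylinder contains [x]. *)
Lemma random_cellP n w x : random_cell n w x = set0 \/
  (subinterval (random_cell n w x) /\ random_cell n w x x).
Proof.
rewrite /cell; case: xgetP => [A _ [JA Ax]|_]; last by left.
right; split => //.
apply: (@join_partitions_subinterval _ (fun k => T (w k))
  (random_iter T w) (fun k => range (alpha (w k))) _ _ _ _ n) => //.
- by move=> k _ [j _ <-].
- by move=> k _ [j _ <-].
Qed.

Lemma neg_log_cell_le (e r : R) n m w x : regular S E x ->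
  ~ near_ends S E (expR (- r)) m x -> ~ far_cells S mut E e m x ->
  ~ (random_cell n w x `<=` cell (En m) x) ->
  (neg_log_cell n w x <= m%:R * hS + e * Num.sqrt m%:R + r)%R.
Proof.
move=> rx nnear nfar nsub.
(* The default cell [set0] is contained in every set, so [nsub] excludes it. *)
have [C0|[iC Cx]] := random_cellP n w x; first by case: nsub; rewrite C0.
have [EA Ax _] := cellP (regular_unique_cell m rx).
have iA := ntfm_cylinder_subinterval ntfmS EA.
have [A0 AC] := near_end_escape (expR_ge0 _) iA iC Ax Cx
  (not_near_ends rx nnear) nsub.
have := not_far_cells rx nfar.
rewrite /information_gap ler_norml => /andP[_].
have : (ln (expR (- r) * fine (lambda (cell (En m) x))) <=
    ln (fine (lambda (random_cell n w x))))%R.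
  have eA0 : (0 < expR (- r) * fine (lambda (cell (En m) x)))%R.
    by rewrite mulr_gt0// expR_gt0.
  by rewrite ler_ln ?posrE ?(ltW AC)// (lt_trans eA0).
rewrite lnM ?posrE ?expR_gt0// expRK; lra.
Qed.

(** Nesting replaces the unknown level [m'] by the fixed [m], so only the far cells of level [m]
    must be avoided. Positivity keeps the default [ln 0 = 0] out. *)
Lemma neg_log_cell_ge (e : R) n m m' w x : regular S E x ->
  ~ far_cells S mut E e m x -> (m <= m')%N ->
  random_cell n w x `<=` cell (En m') x ->
  (0 < fine (lambda (random_cell n w x)))%R ->
  (m%:R * hS - e * Num.sqrt m%:R <= neg_log_cell n w x)%R.
Proof.
move=> rx nfar mm' sub C0.
have [EA Ax _] := cellP (regular_unique_cell m rx).
have mA := ntfm_cylinder_measurable ntfmS EA.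
have mC : measurable (random_cell n w x).
  have [->//|[/subinterval_measurable//]] := random_cellP n w x.
have CA : (fine (lambda (random_cell n w x)) <= fine (lambda (cell (En m) x)))%R.
  rewrite fine_le ?fin_num_measure//; apply: le_measure; rewrite ?inE//.
  by apply: subset_trans sub _; exact: regular_cell_nested.
have := not_far_cells rx nfar.
rewrite /information_gap ler_norml => /andP[+ _].
have : (ln (fine (lambda (random_cell n w x))) <=
    ln (fine (lambda (cell (En m) x))))%R.
  by rewrite ler_ln ?posrE// (lt_le_trans C0).
lra.
Qed.

Lemma measurable_snd_preimage (W : set U) :
  measurable W -> measurable (snd @^-1` W : set (IN * U)).
Proof. by move=> mW; rewrite -[X in measurable X]setTI; exact: measurable_snd. Qed.

Lemma product_snd_preimage (W : set U) : measurable W ->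
  (P \x lambda) (snd @^-1` W) = lambda W.
Proof.
move=> mW; have -> : snd @^-1` W = setT `*` W :> set (IN * U).
  by apply/seteqP; split => [[w x]//|[w x] []].
rewrite product_measure1E//.
by rewrite -[RHS]mul1e; congr (_ * _); exact: probability_setT.
Qed.

Lemma not_regular_mu_ext : (mu^*)%mu [set z | ~ regular S E z.2] = 0.
Proof.
apply: mu_ext_negligible.
have [B [mB B0 NB]] := not_regular_negligible ntfmS.
exists (snd @^-1` B); split; first exact: measurable_snd_preimage.
  apply: mu_dominated; first exact: measurable_snd_preimage.
  by rewrite product_snd_preimage.
by move=> z /NB.
Qed.

Lemma far_cells_cvg0 (e : R) : (0 < e)%R -> zero_property S mut E ->
  (fun n => (mu^*)%mu (snd @^-1` far_cells S mut E e n)) @ \oo --> 0.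
Proof.
move=> e0 zeroS.
have mF n : measurable (snd @^-1` far_cells S mut E e n : set (IN * U)).
  by apply: measurable_snd_preimage; exact: far_cells_measurable ntfmS _ _.
under eq_fun do rewrite measurable_mu_extE//.
apply: lim_sup_set_cvg_null => //.
rewrite (_ : lim_sup_set _ = snd @^-1` lim_sup_set (far_cells S mut E e)).
  have mL : measurable (lim_sup_set (far_cells S mut E e)).
    apply: bigcapT_measurable => k; apply: bigcup_measurable => j _.
    exact: far_cells_measurable ntfmS _ _.
  apply: mu_dominated; first exact: measurable_snd_preimage.
  by rewrite product_snd_preimage// lim_sup_far_cells.
by [].
Qed.

(** Here only the measures under [P \x lambda] are known to vanish, not that of the limit superior,
    so [cvg_measure_dominated] carries out the transfer to [mu]. *)
Lemma near_ends_cvg0 (e : nat -> R) (m : nat -> nat) :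
  (forall n, 0 <= e n)%R -> e @ \oo --> (0 : R)%R ->
  (fun n => (mu^*)%mu (snd @^-1` near_ends S E (e n) (m n))) @ \oo --> 0.
Proof.
move=> e_ge0 e0.
have mW n : measurable (near_ends S E (e n) (m n)).
  exact: near_ends_measurable ntfmS _ _.
have mF n : measurable (snd @^-1` near_ends S E (e n) (m n) : set (IN * U)).
  exact: measurable_snd_preimage (mW n).
under eq_fun do rewrite measurable_mu_extE//.
apply: (@cvg_measure_dominated _ _ _ (P \x lambda) mu) => //.
apply: (@squeeze_cvge _ _ _ _ (cst 0) _ (fun n => (2 * e n)%:E)).
- apply: nearW => n; rewrite measure_ge0 andTb /=.
  by rewrite (product_snd_preimage (mW n));
    exact: (lambda_near_ends ntfmS (m n) (e_ge0 n)).
- exact: cvg_cst.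
- apply: cvg_EFin; first by apply: nearW => n.
  by rewrite -(mulr0 (2 : R)%R); apply: cvgM => //; exact: cvg_cst.
Qed.

End matching.

(** * Growth of [sqrt n], and the matching-level event as a condition on levels *)

Lemma sqrt_nat_ge (R : realType) (B : R) :
  \forall n \near \oo, (B <= Num.sqrt n%:R)%R.
Proof.
near=> n; have [B0|/ltW B0] := leP 0%R B; last exact: le_trans B0 (sqrtr_ge0 _).
rewrite -[leLHS]ger0_norm// -sqrtr_sqr ler_wsqrtr//.
by near: n; exact: nbhs_infty_ger.
Unshelve. all: by end_near. Qed.

Lemma cvg_expRN_sqrt (R : realType) (d : R) : (0 < d)%R ->
  (fun n => expR (- (d * Num.sqrt n%:R)) : R) @ \oo --> (0 : R)%R.
Proof.
move=> d0; apply/cvgr0Pnorm_le => e e0.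
near=> n; rewrite ger0_norm ?expR_ge0//.
rewrite -[leRHS]lnK ?posrE// ler_expR lerNl -ler_pdivrMl//.
near: n; exact: sqrt_nat_ge.
Unshelve. all: by end_near. Qed.

Lemma centered_le (R : realType) (M : \bar R) (r c u : R) : (0 < c)%R ->
  ((M - r%:E) * (c^-1)%:E <= u%:E) = (M <= (r + u * c)%:E).
Proof.
move=> c0; rewrite lee_pdivrMr// -EFinM leeBlDr//.
by rewrite -EFinD addrC.
Qed.

Lemma matching_level_le (R : realType) (I : ptopologicalType)
    (T : I -> unitI R -> unitI R) (alpha : I -> nat -> set (unitI R))
    (S : unitI R -> unitI R) (E : set (set (unitI R))) n
    (w : seqs nat (g_sigma_algebraType (@open I))) (x : unitI R) (t : R) :
  (0 <= t)%R ->
  matching_level T alpha S E n w x <= t%:E <->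
  forall m, (0 < m)%N ->
    cell (random_cylinders T alpha w n) x `<=` cell (iterated_join S E m) x ->
    (m%:R <= t)%R.
Proof.
move=> t0; rewrite /matching_level; split.
  rewrite ge_max => /andP[_ supt] m m0 sub; rewrite -lee_fin.
  by apply: le_trans supt; apply: ereal_sup_ubound; exists m.
move=> mt; rewrite ge_max lee_fin t0/=; apply: ge_ereal_sup => _ [m [m0 sub] <-].
by rewrite lee_fin mt.
Qed.

(** * The level at which the cylinders are compared *)

Section level_index.
Variables (R : realType) (h k c u : R).
Hypotheses (h0 : (0 < h)%R) (k0 : (0 < k)%R).

(** The bound that the event for [u] puts on the matching level, with [hfib], [hS], [kappa] for [h],
    [k], [c]. *)
Definition level_threshold (n : nat) : R := (n%:R * (h / k) + u * (c * Num.sqrt n%:R))%R.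
Definition level_index (n : nat) : nat := (Num.truncn (level_threshold n)).+1.

Lemma level_threshold_ge :
  \forall n \near \oo, (Num.sqrt n%:R <= level_threshold n)%R.
Proof.
have hk : (0 < h / k)%R by rewrite divr_gt0.
near=> n.
(* With [s = sqrt n] the threshold is [s * (s * (h / k) + u * c)]; from this bound on the second
   factor is at least 1. *)
have sB : ((1 - u * c) / (h / k) <= Num.sqrt n%:R)%R by near: n; exact: sqrt_nat_ge.
rewrite /level_threshold; set s := Num.sqrt n%:R in sB *.
have -> : (n%:R = s ^+ 2 :> R)%R by rewrite sqr_sqrtr.
have s0 : (0 <= s)%R by exact: sqrtr_ge0.
have -> : (s ^+ 2 * (h / k) + u * (c * s) = s * (s * (h / k) + u * c))%R by ring.
rewrite -[leLHS]mulr1 ler_wpM2l//.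
by move: sB; rewrite ler_pdivrMr// lerBlDr.
Unshelve. all: by end_near. Qed.

Lemma level_index_gt n : (level_threshold n < (level_index n)%:R)%R.
Proof. exact: truncnS_gt. Qed.

Lemma level_index_le n : (0 <= level_threshold n)%R ->
  ((level_index n)%:R <= level_threshold n + 1)%R.
Proof. by move=> t0; rewrite -natr1 lerD2r truncn_le. Qed.

Lemma level_index_cvg : level_index @ \oo --> \oo.
Proof.
apply/cvgnyPge => M; near=> n.
rewrite -(ler_nat R); apply: le_trans (ltW (level_index_gt n)).
apply: (@le_trans _ _ (Num.sqrt n%:R)%R).
  by near: n; exact: sqrt_nat_ge.
by near: n; exact: level_threshold_ge.
Unshelve. all: by end_near. Qed.

(** Turns errors of order [sqrt m] at level [m] into errors of order [sqrt n]. *)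
Lemma sqrt_level_index : exists2 C : R, (0 < C)%R &
  \forall n \near \oo, (Num.sqrt (level_index n)%:R <= C * Num.sqrt n%:R)%R.
Proof.
have hk : (0 < h / k)%R by rewrite divr_gt0.
(* The last 1 pays for rounding up and gives [C <= C ^+ 2]. *)
pose C := (h / k + `|u * c| + 1)%R.
have C1 : (1 <= C)%R by rewrite lerDr addr_ge0// ltW.
exists C; first by rewrite (lt_le_trans ltr01).
near=> n.
have s1 : (1 <= Num.sqrt n%:R :> R)%R by near: n; exact: sqrt_nat_ge.
have st : (Num.sqrt n%:R <= level_threshold n)%R.
  by near: n; exact: level_threshold_ge.
set s := Num.sqrt n%:R in s1 st *.
have s0 : (0 <= s)%R by rewrite (le_trans ler01).
have Cs0 : (0 <= C * s)%R by rewrite mulr_ge0// (le_trans ler01).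
rewrite -[leRHS]ger0_norm// -sqrtr_sqr ler_wsqrtr//.
apply: le_trans (level_index_le (le_trans s0 st)) _.
apply: (@le_trans _ _ (C * s ^+ 2)%R); last first.
  by rewrite exprMn ler_wpM2r ?sqr_ge0// expr2 ler_peMl// (le_trans ler01).
rewrite /level_threshold -/s /C.
have -> : (n%:R = s ^+ 2 :> R)%R by rewrite sqr_sqrtr.
have : (u * (c * s) <= `|u * c| * s ^+ 2)%R.
  rewrite mulrA expr2 mulrA.
  apply: (@le_trans _ _ (`|u * c| * s)%R); first by rewrite ler_wpM2r// ler_norm.
  by rewrite ler_peMr// mulr_ge0.
have : (1 <= s ^+ 2)%R by rewrite exprn_ege1.
lra.
Unshelve. all: by end_near. Qed.

End level_index.

(** * Transfer of the central limit theorem to the matching level *)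

Theorem theorem3p3 (R : realType) (I : ptopologicalType)
    (P : probability (seqs nat (g_sigma_algebraType (@open I))) R)
    (T : I -> unitI R -> unitI R)
    (mu : probability
       (seqs nat (g_sigma_algebraType (@open I)) * unitI R)%type R)
    (alpha : I -> nat -> set (unitI R))
    (muh : probability
       (seqs int (g_sigma_algebraType (@open I)) * unitI R)%type R)
    (sigma : R)
    (S : unitI R -> unitI R) (mut : probability (unitI R) R)
    (E : set (set (unitI R)))
    (polishI : polish R I)
    (extmu : is_two_sided_extension T mu muh)
    (rnsT : random_number_system P T mu alpha muh)
    (cltT : clt_property T mu alpha muh sigma)
    (ntfmS : ntfm S mut E)
    (zeroS : zero_property S mut E)
    (hfib_fin : 0 < fiber_entropy T muh < +oo)
    (hS_fin : 0 < ks_entropy mut S < +oo)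
    (u : R) :
  let hfib : R := fine (fiber_entropy T muh) in
  let hS : R := fine (ks_entropy mut S) in
  let kappa : R := (sigma / hS)%R in
  (fun n : nat => (mu^*)%mu [set z |
     (matching_level T alpha S E n z.1 z.2 - (n%:R * (hfib / hS))%:E)
       * ((kappa * Num.sqrt n%:R)^-1)%:E <= u%:E])
  @ \oo --> std_normal_cdf u.
Proof.
move=> hfib hS kappa.
have h0 : (0 < hfib)%R by rewrite fine_gt0.
have k0 : (0 < hS)%R by rewrite fine_gt0.
have [sigma0 clt] := cltT.
have kappa0 : (0 < kappa)%R by rewrite divr_gt0.
have mono i j : strictly_monotone_on (alpha i j) (T i).
  by have [] := rns_branches rnsT i j.
have itv := rns_subinterval rnsT.
have dom A : measurable A -> (P \x lambda) A = 0 -> mu A = 0.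
  by move=> mA /(rns_ergodic_equivalent rnsT).2; exact.
pose q A := fine ((mu^*)%mu A).
have qE A : (mu^*)%mu A = (q A)%:E by rewrite fineK// mu_ext_fin_num.
have qU A B : (q (A `|` B) <= q A + q B)%R by exact: fine_mu_extU.
have qS A B : A `<=` B -> (q A <= q B)%R by exact: le_fine_mu_ext.
pose Phi v := fine (@std_normal_cdf R v).
have PhiE v : std_normal_cdf v = (Phi v)%:E.
  by rewrite fineK// std_normal_cdf_fin_num.
pose C n (z : seqs nat (g_sigma_algebraType (@open I)) * unitI R) :=
  cell (random_cylinders T alpha z.1 n) z.2.
pose L n v := [set z | ((- ln (fine (lambda (C n z))) - n%:R * hfib) /
  (sigma * Num.sqrt n%:R) <= v)%R].
have LP n v z : (0 < Num.sqrt n%:R :> R)%R -> L n v z =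
    (- ln (fine (lambda (C n z))) <= n%:R * hfib + v * (sigma * Num.sqrt n%:R))%R :> Prop.
  move=> s0; rewrite /L/= ler_pdivrMr ?mulr_gt0// lerBlDr.
  by rewrite addrC.
pose t n := level_threshold hfib hS kappa u n.
pose m n := level_index hfib hS kappa u n.
pose M n := [set z : seqs nat (g_sigma_algebraType (@open I)) * unitI R |
  (matching_level T alpha S E n z.1 z.2 - (n%:R * (hfib / hS))%:E)
    * ((kappa * Num.sqrt n%:R)^-1)%:E <= u%:E].
have MP n z : (0 < Num.sqrt n%:R :> R)%R -> (0 <= t n)%R -> M n z <->
    forall m, (0 < m)%N -> C n z `<=` cell (iterated_join S E m) z.2 -> (m%:R <= t n)%R.
  move=> s0 t0; rewrite /M/= (centered_le _ _ _ (mulr_gt0 kappa0 s0)).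
  exact: matching_level_le.
have [Cm Cm0 sqrtm] := sqrt_level_index kappa u h0 k0.
(* Since [kappa * hS = sigma], the threshold times [hS] is exactly the bound of the CLT event for
   [u]. *)
have tk j : (t j * hS = j%:R * hfib + u * (sigma * Num.sqrt j%:R))%R.
  by rewrite /t /level_threshold /kappa; field; rewrite gt_eqF.
pose N0 := [set z : seqs nat (g_sigma_algebraType (@open I)) * unitI R |
  ~ regular S E z.2].
have qN0 : q N0 = 0%R.
  by rewrite /q (not_regular_mu_ext dom ntfmS).
pose F d n := snd @^-1` far_cells S mut E d (m n) :
  set (seqs nat (g_sigma_algebraType (@open I)) * unitI R).
pose W d n := snd @^-1` near_ends S E (expR (- (d * Num.sqrt n%:R))) (m n) :
  set (seqs nat (g_sigma_algebraType (@open I)) * unitI R).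
have qF d e : (0 < d -> 0 < e -> \forall n \near \oo, q (F d n) < e)%R.
  move=> d0 e0.
  have FP := far_cells_cvg0 dom ntfmS d0 zeroS.
  have := cvge_near_bounds (cvg_comp _ _ (level_index_cvg kappa u h0 k0) FP) e0.
  by apply: filterS => n /andP[_]; rewrite /= add0r qE lte_fin.
have qW d e : (0 < d -> 0 < e -> \forall n \near \oo, q (W d n) < e)%R.
  move=> d0 e0.
  have WP := near_ends_cvg0 dom ntfmS m (fun n => expR_ge0 _) (cvg_expRN_sqrt d0).
  have := cvge_near_bounds WP e0.
  by apply: filterS => n /andP[_]; rewrite /= add0r qE lte_fin.
have qL v e : (0 < e -> \forall n \near \oo, Phi v - e < q (L n v) < Phi v + e)%R.
  move=> e0; have := clt v; rewrite PhiE => /cvge_near_bounds - /(_ e e0).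
  by apply: filterS => n; rewrite qE !lte_fin.
pose Z n := [set z | fine (lambda (C n z)) = 0%R].
have qZ e : (0 < e -> \forall n \near \oo, q (Z n) < e)%R.
  move=> e0; have e20 : (0 < e / 2)%R by rewrite divr_gt0.
  have [v] := std_normal_cdf_small e20; rewrite PhiE lte_fin => Pv.
  near=> n.
  have s1 : (1 <= Num.sqrt n%:R :> R)%R by near: n; exact: sqrt_nat_ge.
  have sv : (- v * sigma / hfib <= Num.sqrt n%:R)%R by near: n; exact: sqrt_nat_ge.
  have /andP[_ Lv] : (Phi v - e / 2 < q (L n v) < Phi v + e / 2)%R.
    by near: n; exact: qL.
  suff : (q (Z n) <= q (L n v))%R by move=> ?; lra.
  (* On [Z n] the logarithm is 0, and [sv] makes the CLT bound for [v] nonnegative. *)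
  apply: qS => z Zz; rewrite LP ?(lt_le_trans ltr01)// Zz ln0// oppr0.
  move: sv; rewrite ler_pdivrMr//; set s := Num.sqrt n%:R in s1 * => sv.
  have -> : (n%:R * hfib + v * (sigma * s) = s * (s * hfib - - v * sigma))%R.
    have -> : (n%:R = s ^+ 2 :> R)%R by rewrite sqr_sqrtr.
    by ring.
  by rewrite mulr_ge0 ?subr_ge0// (le_trans ler01).
rewrite PhiE; apply: cvge_squeeze_eps => e e0.
have peak0 : (0 < @normal_peak R 1)%R by rewrite normal_peak_gt0// oner_neq0.
(* The error [e] is split in four: the shift by [rho], the CLT, and two exceptional sets on each
   side. *)
pose rho := (e / 4 / normal_peak 1)%R.
have rho0 : (0 < rho)%R by rewrite !divr_gt0.
have PhiL v : (Phi (v + rho) <= Phi v + e / 4)%R.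
  have := @std_normal_cdf_lipschitz R v (v + rho).
  rewrite lerDl (ltW rho0) !PhiE addrAC subrr add0r mulrC divfK ?gt_eqF//.
  by rewrite -EFinD lee_fin; apply.
clearbody rho.
(* The far-cell error [d * Cm * sqrt n] and the near-end error [d * sqrt n] together use half of the
   slack [sigma * rho * sqrt n]. *)
pose d := (sigma * rho / (2 * (Cm + 1)))%R.
have d0 : (0 < d)%R by rewrite divr_gt0 ?mulr_gt0 ?addr_gt0.
have dC : (d * (Cm + 1) = sigma * rho / 2)%R.
  by rewrite /d; field; rewrite gt_eqF// addr_gt0.
have e40 : (0 < e / 4)%R by rewrite divr_gt0.
near=> n.
have s1 : (1 <= Num.sqrt n%:R :> R)%R by near: n; exact: sqrt_nat_ge.
have s0 : (0 < Num.sqrt n%:R :> R)%R by exact: lt_le_trans s1.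
(* The other half of the slack absorbs [hS], the cost of rounding [t n] up to [m n]. *)
have sk : (hS / (sigma * rho / 2) <= Num.sqrt n%:R)%R by near: n; exact: sqrt_nat_ge.
have st : (Num.sqrt n%:R <= t n)%R by near: n; exact: level_threshold_ge.
have t0 : (0 <= t n)%R by exact: le_trans (ltW s0) st.
have mC : (Num.sqrt (m n)%:R <= Cm * Num.sqrt n%:R)%R by near: n.
have mgt : (t n < (m n)%:R)%R by exact: level_index_gt.
have mle : ((m n)%:R <= t n + 1)%R by exact: level_index_le.
have qFn : (q (F d n) < e / 4)%R by near: n; exact: qF.
have qWn : (q (W d n) < e / 4)%R by near: n; exact: qW.
have qZn : (q (Z n) < e / 4)%R by near: n; exact: qZ.
have /andP[_ Lu] : (Phi (u + rho) - e / 4 < q (L n (u + rho)) < Phi (u + rho) + e / 4)%R.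
  by near: n; exact: qL.
have /andP[Ll _] : (Phi (u - rho) - e / 4 < q (L n (u - rho)) < Phi (u - rho) + e / 4)%R.
  by near: n; exact: qL.
have dm : (d * Num.sqrt (m n)%:R <= d * (Cm * Num.sqrt n%:R))%R.
  by rewrite ler_wpM2l// ltW.
have dCs : (d * (Cm * Num.sqrt n%:R) + d * Num.sqrt n%:R =
    sigma * rho / 2 * Num.sqrt n%:R)%R by rewrite -dC; ring.
have ds0 : (0 < d * Num.sqrt n%:R)%R by rewrite mulr_gt0.
rewrite -/(M n) qE !lee_fin; apply/andP; split.
- have sub : L n (u - rho)%R `<=` M n `|` (Z n `|` (F d n `|` N0)).
    move=> z; rewrite LP// => Lz.
    have [rz|] := pselect (regular S E z.2); last by right; right; right.
    have [Fz|nF] := pselect (F d n z); first by right; right; left.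
    have [Zz|nZ] := pselect (Z n z); first by right; left.
    left; apply/MP => // m' m'0 sub; rewrite leNgt; apply/negP => tm'.
    (* A matching level above [t n] is at least [m n]; the lower bound on the negative logarithm
       then contradicts [Lz]. *)
    have mm' : (m n <= m')%N.
      by rewrite /m /level_index truncn_lt_nat.
    have C0 : (0 < fine (lambda (C n z)))%R.
      by rewrite lt_neqAle fine_ge0// ?measure_ge0// andbT eq_sym; apply/eqP.
    have := neg_log_cell_ge mono itv ntfmS rz nF mm' sub C0.
    have : (t n * hS <= (m n)%:R * hS)%R by rewrite ler_wpM2r// ltW.
    rewrite tk -/hS -/(C n z).
    have : (0 < sigma * rho * Num.sqrt n%:R)%R by rewrite !mulr_gt0.
    move: Lz dm dCs ds0; rewrite mulrBl; lra.
  have := qS _ _ sub.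
  have := qU (M n) (Z n `|` (F d n `|` N0)).
  have := qU (Z n) (F d n `|` N0).
  have := qU (F d n) N0.
  have := PhiL (u - rho)%R; rewrite subrK qN0; lra.
- have sub : M n `<=` L n (u + rho)%R `|` (W d n `|` (F d n `|` N0)).
    move=> z; rewrite MP// => Mz.
    have [rz|] := pselect (regular S E z.2); last by right; right; right.
    have [Fz|nF] := pselect (F d n z); first by right; right; left.
    have [Wz|nW] := pselect (W d n z); first by right; left.
    left; rewrite LP//.
    (* [m n] is positive and exceeds [t n], so containment at this level would violate [Mz]. *)
    have nsub : ~ (C n z `<=` cell (iterated_join S E (m n)) z.2).
      by move=> /(Mz _ (ltn0Sn _)); rewrite leNgt mgt.
    have := neg_log_cell_le mono itv ntfmS rz nW nF nsub.
    have : ((m n)%:R * hS <= (t n + 1) * hS)%R by rewrite ler_wpM2r// ltW.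
    rewrite [X in (_ <= X)%R]mulrDl tk mul1r -/hS -/(C n z).
    move: sk; rewrite ler_pdivrMr ?divr_gt0 ?mulr_gt0//.
    move: dm dCs; rewrite mulrDl; lra.
  have := qS _ _ sub.
  have := qU (L n (u + rho)%R) (W d n `|` (F d n `|` N0)).
  have := qU (W d n) (F d n `|` N0).
  have := qU (F d n) N0.
  have := PhiL u; rewrite qN0; lra.
Unshelve. all: by end_near. Qed.
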